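(* Let $G$ be a unicyclic graph with $n \ge 4$ vertices and maximum degree $\Delta \ge 3$, and let $f : [1,\infty) \to \mathbb{R}$ be a convex function. Then $$ I_f(G) \ge f(\Delta) + (n-\Delta+1) f(2) + (\Delta-2) f(1), $$ and the inequality is attained (i.e., equality holds) if and only if $G \in \mathcal{H}_n^\Delta$.
   Context: All graphs are finite, connected, simple (no loops, no multiple edges) and have at least one edge. A unicyclic graph is a graph containing exactly one cycle. For a vertex $u$ of $G$, $d_u$ denotes its degree. For a function $f:[1,\infty)\to\mathbb{R}$, $I_f(G) = \sum_{u\in V(G)} f(d_u)$. For $n\ge 4$ and $3\le \Delta\le n-1$, $\mathcal{H}_n^\Delta$ is the set of graphs (up to isomorphism) obtained from a cycle $C_k$, with $3\le k\le n-\Delta+2$, by attaching to one and the same vertex of the cycle $\Delta-2$ paths of lengths $m_1,\dots,m_{\Delta-2}\ge 1$ (each path having that cycle vertex as an end-vertex, and the paths being otherwise disjoint from each other and from the cycle), where $k+m_1+\dots+m_{\Delta-2}=n$. Equivalently, $\mathcal{H}_n^\Delta$ is the set of unicyclic graphs with $n$ vertices whose degree sequence is $(\Delta,2,\dots,2,1,\dots,1)$ with $n-\Delta+1$ entries equal to $2$ and $\Delta-2$ entries equal to $1$.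
   Formalization: The ''only if'' in the equality clause fails for some convex f (f = 0, the bull graph, n = 5, Δ = 3); it is proved for strictly convex f, and also when equality holds for every convex f; the inequality and the ''if'' part hold for all convex f. *)

(* Defs.v *)
From HB Require Import structures.
From mathcomp Require Import all_boot all_order all_algebra.
From mathcomp Require Import all_classical all_reals interval_inference convex.

Set Implicit Arguments.
Unset Strict Implicit.
Unset Printing Implicit Defensive.

Import Order.TTheory GRing.Theory Num.Theory.
Local Open Scope ring_scope.
Local Open Scope convex_scope.

Record sgraph := SGraph {
  svertex :> finType;
  sedge : rel svertex;
  sedge_sym : symmetric sedge;
  sedge_irr : irreflexive sedge }.

Notation "x -- y" := (sedge x y) (at level 30).

Definition connected_graph (G : sgraph) : Prop :=
  forall x y : G, connect (@sedge G) x y.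

Definition degree (G : sgraph) (x : G) : nat := #|[set y : G | x -- y]|.

Definition max_degree (G : sgraph) : nat := (\max_(x : G) degree x)%N.

(* A cycle is given by a list of its vertices in cyclic order. The list depends
   on a starting point and a direction, so the cycle itself, as a subgraph, is
   identified with its set of edges. *)
Definition graph_cycle (G : sgraph) (c : seq G) : Prop :=
  ucycle (@sedge G) c /\ (3 <= size c)%N.

Definition cycle_edges (G : sgraph) (c : seq G) : {set {set G}} :=
  [set [set x; next c x] | x in c].

Definition unicyclic (G : sgraph) : Prop :=
  exists! E : {set {set G}}, exists2 c, graph_cycle c & E = cycle_edges c.

Definition isomorphic (G H : sgraph) : Prop :=
  exists2 phi : G -> H, bijective phi & forall x y, (phi x -- phi y) = (x -- y).

Section GraphOfRel.
Variables (V : finType) (r : rel V).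

Definition sym_rel : rel V := fun x y => (x != y) && (r x y || r y x).

Lemma sym_rel_sym : symmetric sym_rel.
Proof. by move=> x y; rewrite /sym_rel eq_sym orbC. Qed.

Lemma sym_rel_irr : irreflexive sym_rel.
Proof. by move=> x; rewrite /sym_rel eqxx. Qed.

Definition graph_of_rel : sgraph := SGraph sym_rel_sym sym_rel_irr.

End GraphOfRel.

Section CycleWithPaths.
Variables (k p : nat) (m : 'I_p -> nat).

(* [inl i] is the i-th vertex of the cycle C_k, and [inr (Tagged _ a)] with tag
   l is the vertex at distance a + 1 from the cycle on the l-th attached path;
   as a path of length m l, it has m l vertices besides its end on the cycle.
   All the paths are attached to [inl 0]. *)
Definition cwp_vertex : finType := ('I_k + {l : 'I_p & 'I_(m l)})%type.

Definition cwp_arc : rel cwp_vertex := fun x y =>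
  match x, y with
  | inl i, inl j => j == i.+1 %% k :> nat
  | inl i, inr v => (i == 0 :> nat) && (tagged v == 0 :> nat)
  | inr u, inr v => (tag u == tag v) && (tagged v == (tagged u).+1 :> nat)
  | inr _, inl _ => false
  end%N.

Definition cycle_with_paths : sgraph := graph_of_rel cwp_arc.

End CycleWithPaths.

Definition in_H (n Delta : nat) (G : sgraph) : Prop :=
  exists (k : nat) (m : 'I_(Delta - 2) -> nat),
    [/\ (3 <= k <= n - Delta + 2)%N,
        (forall l, 1 <= m l)%N,
        (k + \sum_l m l = n)%N
      & isomorphic G (cycle_with_paths k m)].

Definition I_index (R : realType) (f : R -> R) (G : sgraph) : R :=
  \sum_(u : G) f (degree u)%:R.

(* The strict counterpart of [convex_function]. *)
Definition strictly_convex_function (R : realType) (D : set R) (f : R -> R) :=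
  forall t : {i01 R}, 0 < t%:num < 1 ->
    {in D &, forall x y : convex_lmodType R^o, x != y ->
      f (x <| t |> y) < (f x : convex_lmodType R^o) <| t |> f y}.

(* Main.v *)
(* In a connected unicyclic graph, every edge off the cycle joins a vertex to
   its parent, the neighbour closer to the cycle. Hence the degrees sum to 2n,
   and comparing [f] with its chord through 1 and 2 at every vertex but one of
   degree [Delta] gives the inequality, with the gap vanishing for degrees 1
   and 2 only (for strictly convex [f], or for [x ^+ 2]). If all vertices but
   one have degree at most 2, a vertex off the cycle is determined by its
   ancestor next to the cycle and its depth, which are its coordinates in a
   cycle with paths attached at the exceptional vertex. *)

Require Import Defs.
From HB Require Import structures.
From mathcomp Require Import all_boot all_order all_algebra.
From mathcomp Require Import all_classical all_reals interval_inference convex.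
From mathcomp Require Import zify ring lra.

Import Order.TTheory GRing.Theory Num.Theory.
Local Open Scope ring_scope.

Local Open Scope nat_scope.

(** * Distance to the cycle and the forest hanging from it *)

Lemma distance_function {G : sgraph} (c : seq G) (h : G) :
  connected_graph G -> h \in c ->
  exists d : G -> nat, (forall u, (d u == 0) = (u \in c)) /\
    forall u, u \notin c -> exists2 w, u -- w & d u = (d w).+1.
Proof.
move=> Gconn hc.
(* [ball i] is the set of vertices within distance [i] of [c]; below, [d u] is the first [i] whose
   ball contains [u]. *)
pose grow (S : {set G}) := S :|: [set y | [exists x in S, x -- y]].
pose ball i := iter i grow [set x in c].
have ballS i x y : x \in ball i -> x -- y -> y \in ball i.+1.
  move=> xi xy; rewrite /ball iterS inE; apply/orP; right.
  by rewrite inE; apply/exists_inP; exists x.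
have in_ball u : exists i, u \in ball i.
  have /connectP[s] := Gconn h u.
  elim/last_ind: s u => [|s x IHs] u; first by move=> _ ->; exists 0; rewrite inE.
  rewrite rcons_path last_rcons => /andP[/IHs/(_ erefl)[i si] sx] ->.
  by exists i.+1; apply: ballS sx.
pose d u := ex_minn (in_ball u); exists d; split=> u.
  rewrite /d; case: ex_minnP => -[|m] um /(_ 0).
    by rewrite inE in um; rewrite um.
  by rewrite /ball /= inE => h0; apply/esym/negP => /h0.
move=> uc; rewrite /d; case: ex_minnP => -[|m] um umin.
  by rewrite inE (negPf uc) in um.
have /orP[/umin|] : (u \in ball m) || [exists x in ball m, x -- u].
  by move: um; rewrite /ball iterS !inE.
  by rewrite ltnn.
case/exists_inP => w wm wu; exists w; first by rewrite sedge_sym.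
(* With [j = d w]: [j <= m] because [w] lies in [ball m], and [m <= j] because [u] then lies in
   [ball j.+1] while [m.+1] is minimal for [u]. *)
case: ex_minnP => j wj /(_ _ wm) jm.
by apply/eqP; rewrite eqSS eqn_leq jm andbT -ltnS; apply: umin; apply: ballS wu.
Qed.

Definition cycle_adj {T : eqType} (c : seq T) (x y : T) :=
  (x \in c) && (y == next c x) || (y \in c) && (x == next c y).

Lemma cycle_adjC {T : eqType} (c : seq T) (x y : T) :
  cycle_adj c x y = cycle_adj c y x.
Proof. by rewrite /cycle_adj orbC. Qed.

Lemma cycle_edgesP {G : sgraph} (c : seq G) (x y : G) :
  x != y -> ([set x; y] \in cycle_edges c) = cycle_adj c x y.
Proof.
move=> xy; apply/imsetP/orP => [[z zc /setP E]|]; last first.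
  by case=> /andP[zc /eqP ->]; [exists x | exists y] => //; rewrite finset.setUC.
have := E x; rewrite !inE eqxx /= => /esym/orP[]/eqP xz.
  have := E y; rewrite !inE eqxx orbT -xz eq_sym (negPf xy) /= => /esym yn.
  by left; rewrite xz zc -xz yn.
have := E y; rewrite !inE eqxx orbT -xz [y == x]eq_sym (negPf xy) orbF => /esym/eqP yz.
by right; rewrite yz zc xz eqxx.
Qed.

(* A path from [x] to [y] in a spanning subgraph [r] closes up with an edge
   outside [r] to a cycle through that edge. *)
Lemma cycle_through_edge {G : sgraph} (r : rel G) (x y : G) :
  symmetric r -> subrel r (@sedge G) -> x -- y -> ~~ r x y -> connect r x y ->
  exists2 c, graph_cycle c & cycle_adj c x y.
Proof.
move=> rsym rG xy rxy /connectP[s0 /shortenP[s sp us _] yl].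
(* A path with fewer than two edges would force [x = y] or [r x y], both excluded. *)
have s2 : 2 <= size s.
  case: s sp us yl => [|z [|w s]] //= => [_ _ E|/andP[rxz _] _ E].
    by rewrite E sedge_irr in xy.
  by rewrite E rxz in rxy.
exists (x :: s).
  split=> //; rewrite /ucycle us andbT /= rcons_path (sub_path rG sp) /=.
  by rewrite -yl sedge_sym.
(* The successor of the last vertex [y] is [x]: [next_nth] runs past the end of [s] and returns its
   default, the head [x]. *)
apply/orP; right; rewrite yl mem_last andTb.
by rewrite next_nth mem_last index_last // nth_default.
Qed.

(** [p] is a parent map off the cycle, with arbitrary values on it. Being an equality, [forest_adj]
    also excludes all further edges; this is how unicyclicity is recorded. *)
Record rooted_forest {G : sgraph} (c : seq G) (d : G -> nat) (p : G -> G) : Prop :=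
  RootedForest {
  forest_uniq : uniq c;
  forest_size : 3 <= size c;
  forest_depth0 : forall u, (d u == 0) = (u \in c);
  forest_depthS : forall u, u \notin c -> d u = (d (p u)).+1;
  forest_adj : forall x y, (x -- y) =
    [|| cycle_adj c x y, (x \notin c) && (y == p x) | (y \notin c) && (x == p y)] }.

Arguments forest_uniq {G c d p}.
Arguments forest_size {G c d p}.
Arguments forest_depth0 {G c d p}.
Arguments forest_depthS {G c d p}.
Arguments forest_adj {G c d p}.

(* Every vertex off the cycle picks a neighbour closer to the cycle. These edges
   and those of the cycle connect everything, so any further edge would give a
   second cycle. *)
Lemma unicyclic_rooted_forest {G : sgraph} :
  connected_graph G -> unicyclic G -> exists c d p, @rooted_forest G c d p.
Proof.
move=> Gconn [E [[c [/andP[cc uc] c3] ->] Euniq]].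
have [h hc] : exists h, h \in c by case: c c3 {cc uc Euniq} => // h s; exists h; rewrite mem_head.
have [d [d0 dS]] := distance_function c h Gconn hc.
pose p u := odflt u [pick w | u -- w & d u == (d w).+1].
have pP u : u \notin c -> u -- p u /\ d u = (d (p u)).+1.
  move=> /dS[w uw dw]; rewrite /p; case: pickP => [z /andP[uz /eqP]//|/(_ w)].
  by rewrite uw dw eqxx.
pose r x y := [|| cycle_adj c x y, (x \notin c) && (y == p x) | (y \notin c) && (x == p y)].
have rsym : symmetric r by move=> x y; rewrite /r cycle_adjC; congr (_ || _); rewrite orbC.
have rG : subrel r (@sedge G).
  move=> x y /or3P[|/andP[/pP[xp _] /eqP->//]|/andP[/pP[yp _] /eqP->]]; last by rewrite sedge_sym.
  by case/orP=> /andP[zc /eqP->]; [|rewrite sedge_sym]; apply: next_cycle zc.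
have rc : cycle r c.
  by apply: cycle_from_next => // x xc; rewrite /r /cycle_adj xc eqxx.
(* Following [p] lowers the depth at each step until the cycle is reached. *)
have rconn u : connect r u h.
  elim/ltn_ind: (d u) {-2}u (erefl (d u)) => i IHi {}u ui.
  have [uc'|uc'] := boolP (u \in c); first exact: (connect_cycle rc).
  have [_ du] := pP u uc'; apply: (@connect_trans _ _ (p u));
    [apply: connect1 | apply: (IHi _ _ _ erefl)].
    by rewrite /r uc' eqxx orbT.
  by rewrite -ui du.
exists c, d, p; split=> // [u /pP[]//|x y]; rewrite -/(r x y).
apply/idP/idP => [xy|/rG//]; apply/negPn/negP => nxy.
have xny : x != y by apply: contraTneq xy => ->; rewrite sedge_irr.
have [|c' cyc' xyc'] := cycle_through_edge r x y rsym rG xy nxy.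
  by rewrite (connect_trans (rconn x)) // (sym_connect_sym rsym).
(* By uniqueness the new cycle has the same edges as [c], so the edge from [x] to [y] would already
   belong to [c], hence to [r]. *)
case/negP: nxy; rewrite /r -cycle_edgesP // (Euniq (cycle_edges c')) ?cycle_edgesP ?xyc' //.
by exists c'.
Qed.

(** * Degrees in the forest *)

Definition children {G : sgraph} (c : seq G) (p : G -> G) (u : G) :=
  [set w | (w \notin c) && (p w == u)].

(** Equality would give [next c (next c u) = u], hence a cycle of length at most 2; this is a
    computation once [u] is rotated to the front. *)
Lemma next_neq_prev {T : eqType} (c : seq T) (u : T) :
  uniq c -> 3 <= size c -> u \in c -> next c u != prev c u.
Proof.
move=> uc c3 ucin; apply: contraTneq isT => /(congr1 (next c)).
rewrite next_prev //; have [i s cE] := rot_to ucin.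
rewrite -!(next_rot i uc) cE; move: c3 uc.
rewrite -(size_rot i) -(rot_uniq i) cE; case: s {cE} => [|a [|b s]] //= _.
rewrite eqxx !inE !negb_or => /andP[/and3P[ua ub _] _].
by rewrite eq_sym (negPf ua) eqxx => bu; rewrite bu eqxx in ub.
Qed.

Section RootedForest.
Variables (G : sgraph) (c : seq G) (d : G -> nat) (p : G -> G).
Hypothesis F : rooted_forest c d p.

(** A vertex on the cycle sees its two cycle neighbours, one off the cycle sees its parent; all
    other neighbours are children. *)
Lemma forest_degree (u : G) :
  degree u = 1 + (u \in c) + #|children c p u|.
Proof.
have uc := forest_uniq F; rewrite /degree.
have [ucin|ucout] := boolP (u \in c).
  have -> : 1 + true = #|[set next c u; prev c u]%SET|.
    by rewrite finset.cards2 next_neq_prev // (forest_size F).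
  have disj : ([set next c u; prev c u] :&: children c p u = finset.set0)%SET.
    apply/finset.setP => y; rewrite !inE.
    apply/negP => /andP[/orP[]/eqP-> /andP[]]; first by rewrite mem_next ucin.
    by rewrite mem_prev ucin.
  rewrite -finset.cardsUI disj finset.cards0 addn0.
  apply: eq_card => y; rewrite !inE (forest_adj F) /cycle_adj ucin /= [u == p y]eq_sym.
  congr (_ || _); congr (_ || _); apply/andP/eqP => [[yc /eqP ->]|->]; first by rewrite prev_next.
  by rewrite mem_prev next_prev.
(* A parent that was also a child would be both one level above and one level below [u]. *)
have disj : ([set p u] :&: children c p u = finset.set0)%SET.
  apply/finset.setP => y; rewrite !inE.
  apply/negP => /and3P[/eqP-> puc /eqP ppu].
  have := forest_depthS F _ ucout; rewrite (forest_depthS F _ puc) ppu; lia.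
rewrite addn0 -(finset.cards1 (p u)) -finset.cardsUI disj finset.cards0 addn0.
apply: eq_card => y; rewrite !inE (forest_adj F) /cycle_adj (negPf ucout) /= [u == p y]eq_sym.
case: (boolP (y \in c)) => //= yc.
have -> : (u == next c y) = false by apply: contraNF ucout => /eqP->; rewrite mem_next.
by rewrite !orbF.
Qed.

Lemma forest_degree_gt0 (u : G) : 0 < degree u.
Proof. by rewrite forest_degree. Qed.

(** Each vertex off the cycle is a child of exactly one vertex, so the children count the vertices
    off the cycle, and the cycle terms complete them to a second [#|G|]. *)
Lemma forest_sum_degree : \sum_(u : G) degree u = 2 * #|G|.
Proof.
under eq_bigr do rewrite forest_degree.
have -> : \sum_(u : G) (1 + (u \in c) + #|children c p u|) =
    #|G| + (\sum_(u | u \in c) 1 + \sum_(u | u \notin c) 1).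
  rewrite !big_split /= sum1_card -addnA; congr (_ + (_ + _)); first by rewrite -big_mkcond.
  rewrite [RHS](partition_big p predT) //=; apply: eq_bigr => u _.
  by rewrite -sum1_card; apply: eq_bigl => w; rewrite inE.
by rewrite -(bigID (mem c) predT) /= sum1_card addnn mul2n.
Qed.

End RootedForest.

Arguments forest_degree {G c d p}.

(** Lets the cycle be listed from the hub, which then corresponds to [inl 0]. *)
Lemma rooted_forest_rot {G : sgraph} (i : nat) (c : seq G) (d : G -> nat) (p : G -> G) :
  rooted_forest c d p -> rooted_forest (rot i c) d p.
Proof.
move=> F; have uc := forest_uniq F; split.
- by rewrite rot_uniq.
- by rewrite size_rot (forest_size F).
- by move=> u; rewrite mem_rot (forest_depth0 F).
- by move=> u; rewrite mem_rot; apply: (forest_depthS F).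
by move=> x y; rewrite (forest_adj F) /cycle_adj !mem_rot !next_rot.
Qed.

Lemma next_nth_mod {T : eqType} (x : T) (s : seq T) (i : nat) :
  uniq (x :: s) -> i < size (x :: s) ->
  next (x :: s) (nth x (x :: s) i) = nth x (x :: s) (i.+1 %% size (x :: s)).
Proof.
move=> us ilt; rewrite next_nth mem_nth // index_uniq //.
move: ilt; rewrite /= ltnS leq_eqVlt => /orP[/eqP->|ilt].
  by rewrite modnn nth_default.
by rewrite modn_small.
Qed.

Lemma card_cycle_with_paths (k q : nat) (m : 'I_q -> nat) :
  #|cycle_with_paths k m| = k + \sum_l m l.
Proof.
rewrite card_sum card_ord card_tagged sumnE big_map big_enum /=.
by congr (_ + _); apply: eq_bigr => l _; rewrite card_ord.
Qed.

(** * Graphs with at most one vertex of degree above 2 *)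

Section Hub.
Variables (G : sgraph) (c : seq G) (d : G -> nat) (p : G -> G) (v : G).
Hypothesis F : rooted_forest c d p.
Hypothesis deg_le2 : forall u, u != v -> degree u <= 2.

(** A cycle vertex with a child has degree at least 3. *)
Lemma branching_vertex (u w : G) : u \in c -> w \in children c p u -> u = v.
Proof.
move=> uc wu; apply/eqP/negPn/negP => /deg_le2.
by rewrite (forest_degree F) uc (cardD1 w) wu.
Qed.

(** Otherwise no cycle vertex has a child, and induction on depth puts every vertex, [v] included,
    on the cycle. *)
Lemma hub_on_cycle : v \in c.
Proof.
apply/negPn/negP => vc.
suff all_c u : u \in c by rewrite all_c in vc.
elim/ltn_ind: (d u) {-2}u (erefl (d u)) => i IHi {}u ui.
apply/negPn/negP => uc; have du := forest_depthS F _ uc.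
have puc : p u \in c by apply: (IHi _ _ _ erefl); rewrite -ui du.
have /(branching_vertex _ _ puc) pv : u \in children c p (p u) by rewrite inE uc eqxx.
by rewrite pv (negPf vc) in puc.
Qed.

Lemma card_children_le1 (u : G) : u \notin c -> #|children c p u| <= 1.
Proof.
move=> uc; have /deg_le2 : u != v by apply: contraNneq uc => ->; exact: hub_on_cycle.
by rewrite (forest_degree F) (negPf uc).
Qed.

Lemma card_children_hub : #|children c p v| = degree v - 2.
Proof. by rewrite (forest_degree F) hub_on_cycle addnC addnK. Qed.

Lemma depth_gt0 (u : G) : (0 < d u) = (u \notin c).
Proof. by rewrite lt0n (forest_depth0 F). Qed.

Lemma depth_iter (j : nat) (u : G) : j <= d u -> d (iter j p u) = d u - j.
Proof.
elim: j => [|j IHj] ju /=; first by rewrite subn0.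
have dj := IHj (ltnW ju).
have /(forest_depthS F) : iter j p u \notin c by rewrite -depth_gt0 dj subn_gt0.
rewrite dj; lia.
Qed.

(* The ancestor of [u] next to the cycle. *)
Definition top (u : G) : G := iter (d u).-1 p u.

(** The ancestor at depth 1 has its parent on the cycle, and a cycle vertex with a child can only be
    [v]. *)
Lemma top_hub (u : G) : u \notin c -> top u \in children c p v.
Proof.
rewrite -depth_gt0 => u0.
have dt : d (top u) = 1 by rewrite depth_iter; lia.
have tc : top u \notin c by rewrite -depth_gt0 dt.
have tp : top u \in children c p (p (top u)) by rewrite inE tc eqxx.
rewrite -(branching_vertex _ _ _ tp) //.
by rewrite -(forest_depth0 F); have := forest_depthS F _ tc; rewrite dt => -[<-].
Qed.

Lemma top_iter (j : nat) (u : G) : j < d u -> top (iter j p u) = top u.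
Proof.
move=> ju; rewrite /top depth_iter ?(ltnW ju) // -iterD; congr iter; lia.
Qed.

Lemma top_child (u : G) : u \in children c p v -> top u = u.
Proof.
rewrite inE => /andP[uc /eqP pu]; rewrite /top (forest_depthS F) // pu.
by have := hub_on_cycle; rewrite -(forest_depth0 F) => /eqP->.
Qed.

(** At depth 1 a vertex is its own top. Deeper down the parents agree by induction, and a vertex off
    the cycle has at most one child. *)
Lemma top_depth_inj (u u' : G) :
  u \notin c -> u' \notin c -> top u = top u' -> d u = d u' -> u = u'.
Proof.
elim/ltn_ind: (d u) {-2}u u' (erefl (d u)) => i IHi {}u u' ui uc uc' tt dd.
have [d1|d1] := leqP (d u) 1.
  by move: tt; rewrite /top -dd; case: (d u) d1 => [|[]].
have du := forest_depthS F _ uc; have du' := forest_depthS F _ uc'.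
have pc : p u \notin c by rewrite -depth_gt0; lia.
have pc' : p u' \notin c by rewrite -depth_gt0; lia.
have pp : p u = p u'.
  apply: (IHi (d (p u))) => //; try lia.
  by rewrite (top_iter 1 u) ?(top_iter 1 u') // -dd.
by apply: (card_le1_eqP (card_children_le1 _ pc)); rewrite inE ?uc ?uc' ?pp eqxx.
Qed.

End Hub.

(** * The isomorphism with a cycle with attached paths *)

Section HubModel.
Variables (G : sgraph) (v : G) (s : seq G) (d : G -> nat) (p : G -> G).
Hypothesis F : rooted_forest (v :: s) d p.
Hypothesis deg_le2 : forall u, u != v -> degree u <= 2.
Hypothesis deg_hub : 3 <= degree v.

Local Notation c := (v :: s).
Local Notation top := (@top G d p).
Local Notation q := (degree v - 2).

Definition branch (l : 'I_q) : G := nth v (enum (children c p v)) l.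

(** The largest depth on a branch is also its number of vertices, since each depth from 1 up to it
    occurs exactly once. *)
Definition branch_length (l : 'I_q) : nat :=
  \max_(u | (u \notin c) && (top u == branch l)) d u.

Local Notation model := (cycle_with_paths (size c) branch_length).

(** A vertex off the cycle is recovered from its top and its depth. The [pick] always succeeds, so
    its default [v] is never returned. *)
Definition unfold_model (x : model) : G :=
  match x with
  | inl i => nth v c i
  | inr w => odflt v [pick u | [&& u \notin c, top u == branch (tag w)
                                & d u == (tagged w).+1]]
  end.

Lemma size_children_hub : size (enum (children c p v)) = q.
Proof. by rewrite -cardE (card_children_hub _ _ _ _ _ F deg_le2). Qed.

Lemma branch_child (l : 'I_q) : branch l \in children c p v.
Proof. by rewrite -mem_enum mem_nth // size_children_hub. Qed.

Lemma branch_inj : injective branch.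
Proof.
move=> l l' /eqP; rewrite nth_uniq ?enum_uniq ?size_children_hub //.
by move=> /eqP/val_inj.
Qed.

Lemma branch_onto (u : G) : u \in children c p v -> exists l, branch l = u.
Proof.
rewrite -mem_enum => uch; have ult := uch; rewrite -index_mem size_children_hub in ult.
by exists (Ordinal ult); rewrite /branch nth_index.
Qed.

Lemma branch_notin (l : 'I_q) : branch l \notin c.
Proof. by have := branch_child l; rewrite inE => /andP[]. Qed.

Lemma branch_length_gt0 (l : 'I_q) : 0 < branch_length l.
Proof.
have lc := branch_notin l.
apply: leq_trans (leq_bigmax_cond (branch l) _); first by rewrite (depth_gt0 _ _ _ _ F).
by rewrite lc (top_child _ _ _ _ _ F deg_le2) ?branch_child /=.
Qed.

Lemma unfold_model_inr (w : {l : 'I_q & 'I_(branch_length l)}) :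
  [/\ unfold_model (inr w) \notin c, top (unfold_model (inr w)) = branch (tag w)
    & d (unfold_model (inr w)) = (tagged w).+1].
Proof.
rewrite /unfold_model; case: pickP => [u /and3P[uc /eqP tu /eqP du]//|none].
case: w none => l a; rewrite /tag /tagged /= => none.
(* The vertex sought is the ancestor at depth [a.+1] of a deepest vertex [u] of the branch. *)
have [|u /andP[uc /eqP tu] du] :=
    @eq_bigmax_cond G [pred u | (u \notin c) && (top u == branch l)] d.
  apply/card_gt0P; exists (branch l).
  by rewrite inE branch_notin (top_child _ _ _ _ _ F deg_le2) ?branch_child /=.
have alt : a < d u by rewrite -du; exact: ltn_ord a.
have dj : d (iter (d u - a.+1) p u) = a.+1 by rewrite (depth_iter _ _ _ _ F); lia.
have := none (iter (d u - a.+1) p u).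
rewrite -(depth_gt0 _ _ _ _ F) dj (top_iter _ _ _ _ F) ?tu ?eqxx //; lia.
Qed.

Lemma unfold_model_inl (i : 'I_(size c)) : unfold_model (inl i) \in c.
Proof. exact: mem_nth. Qed.

Lemma unfold_model_inj : injective unfold_model.
Proof.
move=> [i|w] [i'|w'].
- move=> /= /eqP; rewrite nth_uniq ?(forest_uniq F) // => /eqP ii.
  by congr inl; apply: val_inj.
- by have [+ _ _] := unfold_model_inr w' => + E; rewrite -E unfold_model_inl.
- by have [+ _ _] := unfold_model_inr w => + E; rewrite E unfold_model_inl.
have [_ t1 d1] := unfold_model_inr w; have [_ t2 d2] := unfold_model_inr w'.
move=> E; rewrite E t2 in t1; rewrite E d2 in d1.
case: w w' t1 d1 {t2 d2 E} => l a [l' a'] /= /branch_inj ll; subst l'.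
by move=> [/val_inj->].
Qed.

Lemma unfold_model_onto (u : G) : exists x, unfold_model x = u.
Proof.
have [uc|uc] := boolP (u \in c).
  have ult := uc; rewrite -index_mem in ult.
  by exists (inl (Ordinal ult)); rewrite /= nth_index.
have [l tl] := branch_onto _ (top_hub _ _ _ _ _ F deg_le2 u uc).
have alt : (d u).-1 < branch_length l.
  rewrite prednK ?(depth_gt0 _ _ _ _ F) //.
  by apply: (leq_bigmax_cond (F := d)); rewrite uc tl eqxx.
exists (inr (Tagged (fun l => 'I_(branch_length l)) (Ordinal alt))).
have [wc tw dw] := unfold_model_inr (Tagged (fun l => 'I_(branch_length l)) (Ordinal alt)).
apply: (top_depth_inj _ _ _ _ _ F deg_le2) => //; first by rewrite tw.
by rewrite dw /= prednK ?(depth_gt0 _ _ _ _ F).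
Qed.

(** The orientation that matches [cwp_arc]: forward along the cycle, and from parent to child off
    it. *)
Definition forest_arc (x y : G) : bool :=
  (x \in c) && (y == next c x) || (y \notin c) && (x == p y).

Lemma unfold_model_arc (x y : model) :
  forest_arc (unfold_model x) (unfold_model y) = cwp_arc x y.
Proof.
rewrite /forest_arc; case: x y => [i|w] [i'|w'].
- rewrite /unfold_model !mem_nth // orbF next_nth_mod ?(forest_uniq F) //.
  by rewrite (nth_uniq _ _ _ (forest_uniq F)) ?ltn_pmod.
- have [wc wt wd] := unfold_model_inr w'; rewrite wc unfold_model_inl.
  have -> : (unfold_model (inr w') == next c (unfold_model (inl i))) = false.
    by apply: contraNF wc => /eqP->; rewrite mem_next unfold_model_inl.
  have dU := forest_depthS F _ wc; rewrite wd in dU; case: dU => dU.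
  (* The parent has depth [tagged w']: if this is 0 the parent is the hub, at index 0 of [c];
     otherwise it is off the cycle and differs from every cycle vertex. *)
  rewrite orFb andTb /cwp_arc; have [a0|a0] := eqVneq (tagged w' : nat) 0.
    have : top (unfold_model (inr w')) \in children c p v by rewrite wt branch_child.
    rewrite /top wd a0 inE => /andP[_ /eqP/= ->].
    rewrite andbT; apply: (@nth_uniq _ v c i 0); rewrite ?(forest_uniq F) //.
  rewrite andbF; apply: contraNF a0 => /eqP E.
  by rewrite dU (forest_depth0 F) -E unfold_model_inl.
- by have [wc _ _] := unfold_model_inr w; rewrite (negPf wc) unfold_model_inl.
have [wc wt wd] := unfold_model_inr w; have [wc' wt' wd'] := unfold_model_inr w'.
have dU := forest_depthS F _ wc'; rewrite wd' in dU; case: dU => dU.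
have topp : (tagged w).+1 = tagged w' -> top (p (unfold_model (inr w'))) = branch (tag w').
  by move=> E; rewrite (top_iter _ _ _ _ F 1) ?wt' // wd' -E.
rewrite (negPf wc) wc' !andTb orFb /cwp_arc [_ == _.+1]eq_sym.
apply/eqP/andP => [E|[/eqP tt /eqP aa]].
  have aa : (tagged w).+1 = tagged w' by rewrite dU -E wd.
  rewrite aa eqxx; split=> //; apply/eqP/branch_inj.
  by rewrite -wt -topp // E.
apply: (top_depth_inj _ _ _ _ _ F deg_le2) => //.
- by rewrite -(depth_gt0 _ _ _ _ F) -dU -aa.
- by rewrite topp // wt tt.
by rewrite -dU wd.
Qed.

Lemma unfold_model_adj (x y : model) : (unfold_model x -- unfold_model y) = (x -- y).
Proof.
have adj x' y' : (unfold_model x' -- unfold_model y') = cwp_arc x' y' || cwp_arc y' x'.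
  rewrite -!unfold_model_arc (forest_adj F) /forest_arc /cycle_adj.
  by rewrite [X in _ || X = _]orbC orbACA.
rewrite adj /= /sym_rel; case: eqVneq => //= ->; rewrite orbb.
by apply/negP => yy; have := sedge_irr (unfold_model y); rewrite adj yy.
Qed.

Lemma hub_in_H : in_H #|G| (degree v) G.
Proof.
have [g fK gK] : bijective unfold_model.
  apply: inj_card_bij unfold_model_inj _.
  rewrite -(card_codom unfold_model_inj); apply/subset_leq_card/fintype.subsetP => u _.
  by have [x <-] := unfold_model_onto u; apply: codom_f.
have sum_n : size c + \sum_l branch_length l = #|G|.
  by rewrite -card_cycle_with_paths; apply: bij_eq_card (Bijective fK gK).
(* Each of the [q] paths has at least one vertex, which bounds the cycle length from above. *)
have sum_ge : q <= \sum_l branch_length l.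
  rewrite -[X in X <= _](card_ord q) -sum1_card; apply: leq_sum => l _.
  exact: branch_length_gt0.
exists (size c), branch_length; split=> //.
- by rewrite (forest_size F) -sum_n; lia.
- exact: branch_length_gt0.
exists g; first by exists unfold_model.
by move=> x y; rewrite -unfold_model_adj !gK.
Qed.

End HubModel.

(** * Degrees in a cycle with paths, and the description of [in_H] by degrees *)

Lemma cwp_arc_functional (k q : nat) (m : 'I_q -> nat) (x y y' : cycle_with_paths k m) :
  (forall i, x = inl i -> i != 0 :> nat) -> cwp_arc x y -> cwp_arc x y' -> y = y'.
Proof.
case: x => [i /(_ i erefl) i0|[l a] _]; case: y y' => [j|w] [j'|w'] /=; rewrite ?(negPf i0) //.
  by move=> /eqP j1 /eqP j2; congr inl; apply: val_inj; rewrite /= j1 j2.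
case: w w' => [l1 a1] [l2 a2] /=; rewrite /tag /tagged /=.
move=> /andP[/eqP ? /eqP aa1] /andP[/eqP ? /eqP aa2]; subst l1 l2.
by congr inr; congr existT; apply: val_inj; rewrite /= aa1 aa2.
Qed.

Lemma cwp_arc_injective (k q : nat) (m : 'I_q -> nat) (x y y' : cycle_with_paths k m) :
  cwp_arc y x -> cwp_arc y' x -> y = y'.
Proof.
case: x => [i|[l a]]; case: y y' => [j|w] [j'|w'] //=.
- move=> /eqP-> /eqP/esym E; congr inl; apply: val_inj => /=.
  have wrap (b : 'I_k) : b.+1 %% k = if b.+1 == k then 0 else b.+1.
    case: eqVneq => [->|bk]; first by rewrite modnn.
    by rewrite modn_small // ltn_neqAle bk ltn_ord.
  by move: E; rewrite !wrap; do 2 case: eqP => //; lia.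
- by move=> /andP[/eqP j0 _] /andP[/eqP j0' _]; congr inl; apply: val_inj; rewrite /= j0 j0'.
- by move=> /andP[_ /eqP->] /andP[].
- by move=> /andP[_ /eqP a0] /andP[_ /eqP a0']; rewrite a0' in a0.
case: w w' => [l1 a1] [l2 a2] /=; rewrite /tag /tagged /=.
move=> /andP[/eqP ? /eqP aa1] /andP[/eqP ? /eqP aa2]; subst l1 l2.
by congr inr; congr existT; apply: val_inj; rewrite /=; move: aa2; rewrite aa1 => -[].
Qed.

(** Every vertex has at most one incoming arc, and away from the attachment vertex at most one
    outgoing arc. *)
Lemma degree_cwp_le2 (k q : nat) (m : 'I_q -> nat) (x : cycle_with_paths k m) :
  (forall i, x = inl i -> i != 0 :> nat) -> degree x <= 2.
Proof.
move=> x0; rewrite /degree.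
apply: (@leq_trans (#|[set y | cwp_arc x y] :|: [set y | cwp_arc y x]|)%SET).
  apply/subset_leq_card/fintype.subsetP => y; rewrite !inE => /andP[_].
  by rewrite /= => ->.
rewrite finset.cardsU (leq_trans (leq_subr _ _)) // -[2]/(1 + 1) leq_add //.
  apply/card_le1_eqP => y y'; rewrite !inE => xy xy'.
  exact: (cwp_arc_functional _ _ _ _ _ _ x0 xy' xy).
apply/card_le1_eqP => y y'; rewrite !inE => xy xy'.
exact: (cwp_arc_injective _ _ _ _ _ _ xy' xy).
Qed.

Lemma degree_isomorphic {G H : sgraph} (phi : G -> H) (x : G) :
  bijective phi -> (forall x y, (phi x -- phi y) = (x -- y)) -> degree (phi x) = degree x.
Proof.
move=> phib phiE; rewrite /degree -(card_imset _ (bij_inj phib)).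
have [psi _ psiK] := phib; apply: eq_card => y; rewrite inE.
by rewrite -(psiK y) phiE mem_imset ?inE //; exact: bij_inj.
Qed.

Lemma in_HP (G : sgraph) (Delta : nat) :
  connected_graph G -> unicyclic G -> max_degree G = Delta -> 3 <= Delta ->
  in_H #|G| Delta G <->
  exists2 v : G, degree v = Delta & forall u, u != v -> degree u <= 2.
Proof.
move=> Gconn Guni maxD D3; split=> [[k [m [/andP[k3 _] _ _ [phi phib phiE]]]]|[v vD le2]].
  have k0 : 0 < k by apply: leq_trans k3.
  have [psi phiK psiK] := phib; pose v := psi (inl (Ordinal k0)).
  have le2 u : u != v -> degree u <= 2.
    move=> uv; rewrite -(degree_isomorphic phi u phib phiE).
    apply: degree_cwp_le2 => i ui; apply: contra_neq uv => i0.
    by rewrite -(phiK u) ui /v; congr (psi (inl _)); apply: val_inj.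
  exists v => //.
  (* The maximum [Delta >= 3] is attained somewhere and [le2] leaves only [v], so the hub's degree
     is found without counting in the model. *)
  have [|w wD] := @bigop.eq_bigmax G (@degree G); first by apply/card_gt0P; exists v.
  have wDelta : degree w = Delta by rewrite -wD.
  have [<-//|/le2] := eqVneq w v; rewrite wDelta; lia.
have [c [d [p F]]] := unicyclic_rooted_forest Gconn Guni.
have vc := hub_on_cycle _ _ _ _ _ F le2.
have [i s cE] := rot_to vc; have := rooted_forest_rot i _ _ _ F; rewrite cE => F'.
by rewrite -vD; apply: (hub_in_H _ _ _ _ _ F' le2); rewrite vD.
Qed.

Local Open Scope ring_scope.

(** * The gap between [f] and its chord through 1 and 2 *)

Definition chord_gap {R : realType} (f : R -> R) (k : nat) : R :=
  f k%:R - (f 1 + (k%:R - 1) * (f 2 - f 1)).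

Lemma chord_gap_le2 {R : realType} (f : R -> R) (k : nat) :
  (0 < k <= 2)%N -> chord_gap f k = 0.
Proof. by case: k => [|[|[|]]] //= _; rewrite /chord_gap; lra. Qed.

(** [t = (k - 2) / (k - 1)] makes 2 an average of 1 and [k]. The convexity defect there is the gap
    divided by [k - 1], so convexity gives the sign of the gap. *)
Lemma two_as_average {R : realType} (k : nat) : (2 < k)%N ->
  exists2 t : {i01 R}, 0 < t%:num < 1 & forall g : R -> R,
    g 2 = g (t%:num * 1 + (1 - t%:num) * k%:R) /\
    t%:num * g 1 + (1 - t%:num) * g k%:R - g 2 = chord_gap g k / (k%:R - 1).
Proof.
move=> k2; have k2R : (2 : R) < k%:R by rewrite ltr_nat.
have k1 : (0 : R) < k%:R - 1 by lra.
have t0 : (0 : R) < (k%:R - 2) / (k%:R - 1) by apply: divr_gt0 => //; lra.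
have t1 : (k%:R - 2) / (k%:R - 1) < (1 : R) by rewrite ltr_pdivrMr //; lra.
exists (Itv01 (ltW t0) (ltW t1)) => /=; first by rewrite t0 t1.
move=> g; split; first by congr g; field; lra.
by rewrite /chord_gap; field; lra.
Qed.

Lemma natr_in_itv {R : realType} (k : nat) : (0 < k)%N -> (k%:R : R) \in `[1, +oo[%classic.
Proof. by move=> k0; rewrite inE /= in_itv /= andbT ler1n. Qed.

Lemma chord_gap_ge0 {R : realType} (f : R -> R) (k : nat) :
  @convex_function R R^o `[1, +oo[%classic f -> (0 < k)%N -> 0 <= chord_gap f k.
Proof.
move=> fconv k0; have [k2|k2] := leqP k 2; first by rewrite chord_gap_le2 ?k0.
have [t _ /(_ f) [E gapE]] := @two_as_average R k k2.
have : 0 <= chord_gap f k / (k%:R - 1).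
  rewrite -gapE E subr_ge0.
  exact: (fconv t 1 k%:R (natr_in_itv 1 isT) (natr_in_itv k k0)).
by rewrite pmulr_lge0 // invr_gt0 subr_gt0 ltr1n; lia.
Qed.

Lemma chord_gap_gt0 {R : realType} (f : R -> R) (k : nat) :
  strictly_convex_function `[1, +oo[%classic f -> (2 < k)%N -> 0 < chord_gap f k.
Proof.
move=> fconv k2; have [t t01 /(_ f) [E gapE]] := @two_as_average R k k2.
have : 0 < chord_gap f k / (k%:R - 1).
  rewrite -gapE E subr_gt0.
  apply: (fconv t t01 1 k%:R (natr_in_itv 1 isT) (natr_in_itv k (ltnW (ltnW k2)))).
  by rewrite lt_eqF // ltr1n; lia.
by rewrite pmulr_lgt0 // invr_gt0 subr_gt0 ltr1n; lia.
Qed.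

Lemma convex_sqr {R : realType} :
  @convex_function R R^o `[1, +oo[%classic (fun x : R => x ^+ 2).
Proof.
move=> t x y _ _; rewrite -subr_ge0.
have t0 : 0 <= t%:num by [].
have t1 : t%:num <= 1 by [].
(* The convexity defect of the square is [t (1 - t) (x - y)^2]. *)
rewrite [X in 0 <= X](_ : _ = t%:num * (1 - t%:num) * ((x : R) - y) ^+ 2); last first.
  rewrite -[LHS]/(t%:num * (x : R) ^+ 2 + (1 - t%:num) * (y : R) ^+ 2
    - (t%:num * (x : R) + (1 - t%:num) * (y : R)) ^+ 2); ring.
by rewrite mulr_ge0 ?sqr_ge0 // mulr_ge0 // subr_ge0.
Qed.

(** The gap of the square is [(k - 1) (k - 2)]. *)
Lemma chord_gap_sqr_gt0 {R : realType} (k : nat) :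
  (2 < k)%N -> 0 < chord_gap (fun x : R => x ^+ 2) k.
Proof.
move=> k2; have k2R : (2 : R) < k%:R by rewrite ltr_nat.
by rewrite /chord_gap; nra.
Qed.

(** Each term off [v] is its gap plus an affine function of the degree, and the affine parts sum to
    a value fixed by [degree v], the number of vertices and the degree sum [2 * #|G|]. *)
Lemma I_index_chord_gap {R : realType} (G : sgraph) (v : G) (f : R -> R) :
  connected_graph G -> unicyclic G ->
  I_index f G = f (degree v)%:R + (#|G|%:R - (degree v)%:R + 1) * f 2
    + ((degree v)%:R - 2) * f 1 + \sum_(u | u != v) chord_gap f (degree u).
Proof.
move=> Gconn Guni; have [c [d [p F]]] := unicyclic_rooted_forest Gconn Guni.
have card_off : (\sum_(u : G | u != v) 1 = #|G|%:R - 1 :> R).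
  by have := sumr_const G (1 : R); rewrite (bigD1 v) //= => <-; lra.
have sum_off : (\sum_(u | u != v) (degree u)%:R = 2 * #|G|%:R - (degree v)%:R :> R).
  have := congr1 (fun k : nat => k%:R : R) (forest_sum_degree _ _ _ _ F).
  rewrite /= natr_sum natrM (bigD1 v) //= => <-; lra.
rewrite /I_index (bigD1 v) //=.
have -> : \sum_(u | u != v) f (degree u)%:R = \sum_(u | u != v) chord_gap f (degree u)
   + (f 1 * (\sum_(u | u != v) 1) + (f 2 - f 1) *
     (\sum_(u | u != v) (degree u)%:R - \sum_(u | u != v) 1)).
  rewrite -sumrB !mulr_sumr -!big_split /=; apply: eq_bigr => u _.
  by rewrite /chord_gap; lra.
by rewrite card_off sum_off; lra.
Qed.

Theorem theorem4p3 (R : realType) (G : sgraph) (n Delta : nat)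
    (hconn : connected_graph G) (huni : unicyclic G)
    (hn : #|G| = n) (hn4 : (4 <= n)%N)
    (hDelta : max_degree G = Delta) (hDelta3 : (3 <= Delta)%N) :
  let lower_bound (f : R -> R) : R :=
    f Delta%:R + (n%:R - Delta%:R + 1) * f 2 + (Delta%:R - 2) * f 1 in
  [/\ forall f : R -> R, @convex_function R R^o `[1, +oo[%classic f ->
        I_index f G >= lower_bound f,
      (forall f : R -> R, @convex_function R R^o `[1, +oo[%classic f ->
        I_index f G = lower_bound f) <-> in_H n Delta G
    & forall f : R -> R, strictly_convex_function `[1, +oo[%classic f ->
        (I_index f G = lower_bound f <-> in_H n Delta G)].
Proof.
have deg_gt0 (u : G) : (0 < degree u)%N.
  have [c [d [p F]]] := unicyclic_rooted_forest hconn huni.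
  exact: (forest_degree_gt0 _ _ _ _ F).
have [v vDelta] : exists v : G, degree v = Delta.
  have [|w wD] := @bigop.eq_bigmax G (@degree G); first by rewrite hn; lia.
  by exists w; rewrite -wD.
move=> lower_bound.
have indexE (w : G) (f : R -> R) : degree w = Delta ->
    I_index f G = lower_bound f + \sum_(u | u != w) chord_gap f (degree u).
  by move=> wDelta; rewrite (I_index_chord_gap G w f hconn huni) wDelta hn.
have HP := in_HP G Delta hconn huni hDelta hDelta3; rewrite hn in HP.
have in_H_eq (f : R -> R) : in_H n Delta G -> I_index f G = lower_bound f.
  move=> /HP[w wDelta le2]; rewrite (indexE w) // big1 ?addr0 // => u /le2 u2.
  by rewrite chord_gap_le2 ?deg_gt0.
have eq_in_H (f : R -> R) : (forall k, (2 < k)%N -> 0 < chord_gap f k) ->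
    I_index f G = lower_bound f -> in_H n Delta G.
  (* Equality makes a sum of nonnegative gaps vanish, so every gap is zero and no vertex but [v] has
     degree above 2. *)
  move=> gap_gt0; rewrite (indexE v) // -[RHS]addr0 => /addrI sum0.
  apply/HP; exists v => // u uv; rewrite leqNgt; apply/negP => u2.
  have gap_ge0 (w : G) : w != v -> 0 <= chord_gap f (degree w).
    move=> _; have [w2|/gap_gt0/ltW//] := leqP (degree w) 2.
    by rewrite chord_gap_le2 ?deg_gt0.
  by have := gap_gt0 _ u2; rewrite (psumr_eq0P gap_ge0 sum0 uv) ltxx.
split=> [f fconv||f fconv].
- rewrite (indexE v) // lerDl sumr_ge0 // => u _.
  exact: chord_gap_ge0.
- split=> [eq|inH f _]; last exact: in_H_eq.
  (* An affine [f] gives equality for every [G], so the hypothesis is applied to a convex function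
     with positive gaps, the square. *)
  apply: (eq_in_H _ chord_gap_sqr_gt0); exact/eq/convex_sqr.
split=> [|/in_H_eq//]; apply: eq_in_H => k; exact: chord_gap_gt0.
Qed.
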